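(* Let $n\ge 2$ and let $\psi$ be a quasiperiodic flow on $T^n$ (generated by a constant vector field). If $M_\psi=\{1,-1\}$, then $\psi$ is transcendental.
   Context: $T^n=\mathbb{R}^n/\mathbb{Z}^n$ is the $n$-torus with global coordinates $(\theta_1,\dots,\theta_n)$. For a smooth ($C^\infty$) flow $\psi:\mathbb{R}\times T^n\to T^n$, its generating vector field is $X_\psi(p)=\frac{d}{dt}\psi(t,p)|_{t=0}$. A constant vector field is one of the form $\sum_{i=1}^n a_i\,\partial/\partial\theta_i$ with $a_i\in\mathbb{R}$. A flow generated by a constant vector field is quasiperiodic if the components $a_1,\dots,a_n$ are linearly independent over $\mathbb{Q}$. Generalized symmetry group: $S_\psi$ is the group of all $R\in\mathrm{Diff}(T^n)$ (smooth diffeomorphisms) for which there is $\alpha\in\mathbb{R}^*=\mathbb{R}\setminus\{0\}$ with $R_*X_\psi=\alpha X_\psi$, where $R_*X_\psi=\mathbf{T}R\,X_\psi\,R^{-1}$ is the push-forward and $\mathbf{T}R$ is the derivative map of $R$. The unique such $\alpha$ is the multiplier $\rho_\psi(R)$, and the multiplier group is $M_\psi=\rho_\psi(S_\psi)\subset\mathbb{R}^*$. A real algebraic number field of degree $n$ over $\mathbb{Q}$ is a subfield of $\mathbb{R}$ that is an $n$-dimensional vector space over $\mathbb{Q}$. A quasiperiodic flow $\psi$ on $T^n$ generated by $X_\psi=\sum a_i\,\partial/\partial\theta_i$ is called $F$-algebraic, for $F$ such a field of degree $n$, if there is $\vartheta\in\mathbb{R}^*$ such that $\{\vartheta a_1,\dots,\vartheta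 a_n\}$ is a $\mathbb{Q}$-basis of $F$. A quasiperiodic flow on $T^n$ is called transcendental if it is not $F$-algebraic for any real algebraic number field $F$ of degree $n$ over $\mathbb{Q}$. *)

(* Defs.v *)
From HB Require Import structures.
From mathcomp Require Import all_boot all_order all_algebra.
From mathcomp Require Import generic_quotient.
From mathcomp Require Import all_classical all_reals all_analysis.

Set Implicit Arguments.
Unset Strict Implicit.
Unset Printing Implicit Defensive.

Import Order.TTheory GRing.Theory Num.Theory.
Import numFieldNormedType.Exports.

Local Open Scope classical_set_scope.
Local Open Scope quotient_scope.
Local Open Scope ring_scope.

Section Torus.
Variables (R : realType) (n : nat).

Definition torus_rel (x y : 'rV[R]_n) : bool :=
  [forall i, (x - y) ord0 i \is a Num.int].

Lemma torus_rel_refl : reflexive torus_rel.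
Proof. by move=> x; apply/forallP => i; rewrite subrr mxE rpred0. Qed.

Lemma torus_rel_sym : symmetric torus_rel.
Proof.
by move=> x y; apply: eq_forallb => i; rewrite -opprB mxE rpredN.
Qed.

Lemma torus_rel_trans : transitive torus_rel.
Proof.
move=> y x z /forallP hxy /forallP hyz; apply/forallP => i.
have -> : x - z = (x - y) + (y - z) by rewrite addrA subrK.
by rewrite mxE rpredD.
Qed.

Canonical torus_equiv :=
  EquivRel torus_rel torus_rel_refl torus_rel_sym torus_rel_trans.

Definition torus : Type := {eq_quot torus_equiv}.

Definition torus_pi (x : 'rV[R]_n) : torus := \pi_{eq_quot torus_equiv} x.

Definition torus_repr (p : torus) : 'rV[R]_n := repr (p : {eq_quot torus_equiv}).

End Torus.

Section Smooth.
Variables (R : realType) (V W : normedModType R).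

(* [U] is meant to be open and [V], [W] finite dimensional: there, f is
   C^(k+1) iff it is differentiable and each directional derivative is C^k. *)
Fixpoint Ck_on (k : nat) (U : set V) (f : V -> W) : Prop :=
  match k with
  | 0 => forall x, U x -> {for x, continuous f}
  | k'.+1 => (forall x, U x -> differentiable f x) /\
             forall v, Ck_on k' U (fun x => 'D_v f x)
  end.

Definition smooth_on (U : set V) (f : V -> W) : Prop :=
  forall k, Ck_on k U f.

End Smooth.

(* The charts of T^n are the local inverses of the covering map
   R^n -> T^n, so reading a map into T^n in charts means lifting it locally
   to R^n; a map out of T^n is read in charts by precomposing it with the
   covering map. *)
Section MapsToTorus.
Variables (R : realType) (n : nat) (V : normedModType R).

Definition smooth_to_torus (f : V -> torus R n) : Prop :=
  forall x, exists U : set V, exists F : V -> 'rV[R]_n,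
    [/\ open U, U x, smooth_on U F & forall y, U y -> torus_pi (F y) = f y].

(* The derivative at [x] of a map into T^n, all tangent spaces of T^n being
   identified with R^n through the frame d/dtheta_1, ..., d/dtheta_n. Two
   local lifts that are differentiable at [x] differ by a constant near [x],
   so the result does not depend on the lift chosen by [xget]. *)
Definition tangent_to_torus (f : V -> torus R n) (x v : V) : 'rV[R]_n :=
  let F := xget (fun=> 0) [set F : V -> 'rV[R]_n |
    (\forall y \near x, torus_pi (F y) = f y) /\ differentiable F x] in
  'd F x v.

End MapsToTorus.

Section Flows.
Variables (R : realType) (n : nat).

Local Notation T := (torus R n).

Definition smooth_torus_map (f : T -> T) : Prop :=
  smooth_to_torus (fun x : 'rV[R]_n => f (torus_pi x)).

Record diffeo : Type := Diffeo {
  diffeo_fun :> T -> T;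
  diffeo_inv : T -> T;
  diffeo_funK : cancel diffeo_fun diffeo_inv;
  diffeo_invK : cancel diffeo_inv diffeo_fun;
  diffeo_smooth : smooth_torus_map diffeo_fun;
  diffeo_inv_smooth : smooth_torus_map diffeo_inv
}.

Record smooth_flow : Type := SmoothFlow {
  flow_fun :> R -> T -> T;
  flow0 : forall p, flow_fun 0 p = p;
  flowD : forall s t p, flow_fun (s + t) p = flow_fun s (flow_fun t p);
  flow_smooth : smooth_to_torus
    (fun z : (R^o * 'rV[R]_n)%type => flow_fun z.1 (torus_pi z.2))
}.

(* A vector field is given by its components in the frame
   d/dtheta_1, ..., d/dtheta_n. *)
Definition vector_field : Type := T -> 'rV[R]_n.

Definition tangent_map (f : T -> T) (p : T) (v : 'rV[R]_n) : 'rV[R]_n :=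
  tangent_to_torus (fun x : 'rV[R]_n => f (torus_pi x)) (torus_repr p) v.

Definition pushforward (f : diffeo) (X : vector_field) : vector_field :=
  fun q => tangent_map f (diffeo_inv f q) (X (diffeo_inv f q)).

Definition generating_field (psi : smooth_flow) : vector_field :=
  fun p => tangent_to_torus (fun t : R^o => psi t p) 0 1.

Definition has_multiplier (psi : smooth_flow) (f : diffeo) (alpha : R) : Prop :=
  alpha != 0 /\
  forall p, pushforward f (generating_field psi) p =
            alpha *: generating_field psi p.

Definition symmetry_group (psi : smooth_flow) : set diffeo :=
  [set f | exists alpha, has_multiplier psi f alpha].

Definition multiplier (psi : smooth_flow) (f : diffeo) : R :=
  xget 0 [set alpha | has_multiplier psi f alpha].

Definition multiplier_group (psi : smooth_flow) : set R :=
  multiplier psi @` symmetry_group psi.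

Definition rat_comb (c : 'I_n -> rat) (a : 'rV[R]_n) : R :=
  \sum_i ratr (c i) * a ord0 i.

Definition rat_free (a : 'rV[R]_n) : Prop :=
  forall c : 'I_n -> rat, rat_comb c a = 0 -> forall i, c i = 0.

Definition rat_basis (F : {pred R}) (a : 'rV[R]_n) : Prop :=
  rat_free a /\ forall x, x \in F <-> exists c, x = rat_comb c a.

(* A real algebraic number field of degree n: every subfield of R contains Q,
   and [F] has dimension n over Q. *)
Definition real_number_field (F : {pred R}) : Prop :=
  divring_closed F /\ exists b, rat_basis F b.

Definition generated_by_constant (psi : smooth_flow) (a : 'rV[R]_n) : Prop :=
  forall p, generating_field psi p = a.

Definition quasiperiodic (psi : smooth_flow) : Prop :=
  exists a, generated_by_constant psi a /\ rat_free a.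

Definition algebraic_flow (F : {pred R}) (psi : smooth_flow) : Prop :=
  exists a, [/\ generated_by_constant psi a, rat_free a &
    exists2 theta : R, theta != 0 & rat_basis F (theta *: a)].

Definition transcendental (psi : smooth_flow) : Prop :=
  quasiperiodic psi /\
  forall F : {pred R}, real_number_field F -> ~ algebraic_flow F psi.

End Flows.

(* Main.v *)
(* If [theta * a] is a basis of a real number field of degree [n >= 2], the
   matrices of multiplication by its elements give integer matrices having [a]
   as an eigenvector. Dirichlet's box principle yields such matrices with
   arbitrarily small nonzero eigenvalue and bounded nonzero determinant; two of
   them, [X] and [Y], with equal determinant [d], congruent modulo [d] and with
   eigenvalues of distinct absolute values give [X = Y U] with [U] in
   [GL_n(Z)]. The toral automorphism defined by [U] is then a symmetry whose
   multiplier is not [1] or [-1]. *)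
Require Import Defs.
From mathcomp Require Import all_boot all_order all_algebra all_fingroup.
From mathcomp Require Import generic_quotient.
From mathcomp Require Import all_classical all_reals all_analysis.
From mathcomp Require Import zify ring lra.
Import Order.TTheory GRing.Theory Num.Theory.
Import numFieldNormedType.Exports.

Local Open Scope classical_set_scope.
Local Open Scope ring_scope.

(** * Units of number fields *)

Lemma det_le_fact_exp (R : numDomainType) n (A : 'M[R]_n) (B : R) :
  (forall i j, `|A i j| <= B) ->
  `|\det A| <= n`!%:R * B ^+ n.
Proof.
move=> hA; apply: (le_trans (ler_norm_sum _ _ _)).
apply: (@le_trans _ _ (\sum_(s : 'S_n) B ^+ n)).
  apply: ler_sum => s _; rewrite normrM normrX normrN1 expr1n mul1r normr_prod.
  rewrite -[n in leRHS]card_ord -prodr_const.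
  by apply: ler_prod => i _; rewrite normr_ge0 hA.
by rewrite sumr_const -card_Sn mulr_natl.
Qed.

Lemma rat_free_int {R : realType} {n} {a : 'rV[R]_n} (c : 'I_n -> int) :
  rat_free a -> \sum_i (c i)%:~R * a ord0 i = 0 -> forall i, c i = 0.
Proof.
move=> fa h i; have /(_ _ i) := fa (fun i => (c i)%:~R).
rewrite /rat_comb; under eq_bigr do rewrite ratr_int.
by move=> /(_ h)/eqP; rewrite intr_eq0 => /eqP.
Qed.

Lemma rat_freeZ {R : realType} {n} {a : 'rV[R]_n} (t : R) :
  t != 0 -> rat_free a -> rat_free (t *: a).
Proof.
move=> t0 fa c h; apply: fa; apply: (mulfI t0).
rewrite mulr0 -h /rat_comb mulr_sumr; apply: eq_bigr => i _.
by rewrite mxE mulrCA.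
Qed.

Lemma rat_free_neq0 {R : realType} {n} {a : 'rV[R]_n} (i : 'I_n) :
  rat_free a -> a ord0 i != 0.
Proof.
move=> fa; apply/eqP => ai0; have /(_ _ i)/eqP := fa (fun j => (j == i)%:R).
rewrite /rat_comb (bigD1 i)//= ai0 mulr0 big1 ?addr0; last first.
  by move=> j /negbTE ->; rewrite rmorph0 mul0r.
by rewrite eqxx oner_eq0 => /(_ erefl).
Qed.

Section IntegerEigenMatrices.
Variables (R : realType) (n : nat) (a : 'rV[R]_n).
Hypotheses (hn : (2 <= n)%N) (fa : rat_free a).

Local Notation "M '^R'" := (map_mx (intr : int -> R) M) (at level 2).

(** A singular [M] kills a nonzero rational column [v]. Then [0 = a M v = x (a v)] is a nontrivial
    rational relation between the entries of [a], contradicting [rat_free a]. *)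
Lemma eigen_det_neq0 (M : 'M[int]_n) (x : R) :
  x != 0 -> a *m M^R = x *: a -> \det M != 0.
Proof.
move=> x0 hM; apply/negP => /eqP dM.
have : \det (map_mx (intr : int -> rat) M)^T == 0.
  by rewrite det_tr det_map_mx dM.
case/det0P => v v0 hv; case/negP: v0; apply/eqP/rowP => i; rewrite [RHS]mxE.
apply: fa i; apply: (mulfI x0); rewrite mulr0.
have e : map_mx intr M *m (map_mx (ratr : rat -> R) v)^T = 0.
  apply: trmx_inj; rewrite trmx_mul trmxK trmx0.
  have -> : (map_mx intr M)^T = map_mx (ratr : rat -> R) (map_mx intr M)^T.
    by apply/matrixP => i j; rewrite !mxE ratr_int.
  by rewrite -map_mxM hv map_mx0.
have := congr1 (mulmx a) e; rewrite mulmxA hM mulmx0 -scalemxAl.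
move=> /matrixP/(_ ord0 ord0); rewrite !mxE => <-; congr (_ * _).
by apply: eq_bigr => i _; rewrite !mxE mulrC.
Qed.

(* Multiplying [a *m M = x *: a] by the adjugate replaces one factor of size
   [B] in the determinant by the eigenvalue. *)
Lemma eigen_det_le (i : 'I_n) (M : 'M[int]_n) (x B : R) :
  a *m M^R = x *: a -> (forall i j, `|M i j|%:~R <= B) ->
  `|a ord0 i| * `|\det M|%:~R <=
    `|x| * (\sum_k `|a ord0 k|) * (n.-1`!%:R * B ^+ n.-1).
Proof.
move=> hM hB.
have e : (\det M)%:~R * a ord0 i = x * \sum_k a ord0 k * (\adj (M^R)) k i.
  have := congr1 (mulmx^~ (\adj (M^R))) hM.
  rewrite -mulmxA mul_mx_adj mul_mx_scalar -scalemxAl det_map_mx.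
  by move=> /matrixP/(_ ord0 i); rewrite !mxE.
rewrite mulrC intr_norm -normrM e normrM -mulrA ler_wpM2l// mulr_suml.
apply: (le_trans (ler_norm_sum _ _ _)); apply: ler_sum => k _.
rewrite normrM ler_wpM2l// mxE /cofactor normrM normrX normrN1 expr1n mul1r.
by apply: det_le_fact_exp => u v; rewrite !mxE -intr_norm.
Qed.

(* Dirichlet's box principle: among the [(Q + 1) ^ n] combinations of [b] with
   coefficients in [0..Q], two fall in the same one of [Q ^ n + 1] boxes. *)
Lemma small_int_comb (b : 'rV[R]_n) (Q : nat) : (0 < Q)%N -> rat_free b ->
  exists c : 'I_n -> int, let x := \sum_i (c i)%:~R * b ord0 i in
    [/\ forall i, `|c i| <= Q%:Z, x != 0 &
        `|x| * Q%:R ^+ n.-1 <= \sum_i `|b ord0 i|].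
Proof.
move=> Q0 fb.
set S := \sum_i _.
have S0 : 0 < S.
  pose i0 := Ordinal (ltnW hn); rewrite /S (bigD1 i0)//=.
  by rewrite ltr_pwDl ?normr_gt0 ?rat_free_neq0// sumr_ge0.
have Q0R : 0 < Q%:R :> R by rewrite ltr0n.
pose s (c : {ffun 'I_n -> 'I_Q.+1}) := \sum_i (c i)%:R * b ord0 i.
(* Least value of the sum when each coefficient ranges over the real interval [[0, Q]]; the greatest
   value exceeds it by [Q * S]. *)
pose m := \sum_i Q%:R * Num.min 0 (b ord0 i).
have hs c : 0 <= s c - m <= Q%:R * S.
  rewrite /s /m -sumrB mulr_sumr; apply/andP; split.
    apply: sumr_ge0 => i _; have : (c i)%:R <= Q%:R :> R.
      by rewrite ler_nat -ltnS.
    have : 0 <= (c i)%:R :> R by [].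
    by rewrite /Num.min; case: ltP => hb; nra.
  apply: ler_sum => i _; have : (c i)%:R <= Q%:R :> R.
    by rewrite ler_nat -ltnS.
  have : 0 <= (c i)%:R :> R by [].
  rewrite /Num.min; case: ltP => hb; [rewrite gtr0_norm//|rewrite ler0_norm//]; nra.
(* Rescaled so that the range becomes [[0, Q ^ n]] and the boxes are the fibres of [Num.trunc];
   being in one box then means differing by at most [S / Q ^ n.-1]. *)
pose t c := (s c - m) / S * Q%:R ^+ n.-1.
have ht c : 0 <= t c <= (Q ^ n)%:R.
  have /andP[h1 h2] := hs c; rewrite /t; apply/andP; split.
    by rewrite mulr_ge0 ?exprn_ge0 ?divr_ge0 ?(ltW S0) ?(ltW Q0R).
  have -> : (Q ^ n)%:R = Q%:R * Q%:R ^+ n.-1 :> R.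
    by rewrite -exprS prednK ?natrX// ltnW.
  by rewrite ler_pM2r ?exprn_gt0// ler_pdivrMr.
have htr c : (Num.trunc (t c) < (Q ^ n).+1)%N.
  have /andP[h1 h2] := ht c.
  by rewrite ltnS -(ler_nat R); apply: le_trans h2; rewrite truncn_le.
have : ~~ injectiveb (fun c => Ordinal (htr c)).
  apply/injectiveP => /leq_card; rewrite card_ffun !card_ord leqNgt => /negP; apply.
  (* The strict inequality [Q ^ n + 1 < (Q + 1) ^ n] is where [2 <= n] enters: for [n = 1] both
     sides equal [Q + 1]. *)
  have -> : n = (n.-2).+2 by case: (n) hn => [|[|]].
  have : (Q ^ n.-2 > 0)%N by rewrite expn_gt0 Q0.
  have : (Q ^ n.-2 <= Q.+1 ^ n.-2)%N by case: (n.-2) => // k; rewrite leq_exp2r.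
  rewrite !expnS; move: (Q ^ n.-2)%N (Q.+1 ^ n.-2)%N => u v; nia.
case/injectivePn => c1 [c2 c12 /(congr1 val)/= hc].
exists (fun i => (c1 i)%:Z - (c2 i)%:Z); set x := (X in X != 0).
have xE : x = s c1 - s c2.
  by rewrite /x /s -sumrB; apply: eq_bigr => i _; rewrite rmorphB/= mulrBl.
split.
- by move=> i; have := ltn_ord (c1 i); have := ltn_ord (c2 i); lia.
- apply: contraNneq c12 => x0; apply/eqP/ffunP => i; apply/val_inj/eqP.
  by rewrite -eqz_nat -subr_eq0; apply/eqP; exact: (rat_free_int _ fb x0).
- have [/andP[t1 _] /andP[t2 _]] := (ht c1, ht c2).
  have := truncn_itv t1; have := truncn_itv t2; rewrite hc => /andP[u1 u2] /andP[v1 v2].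
  have : `|t c1 - t c2| <= 1.
    by move: u2 v2; rewrite -natr1 ler_norml; move: u1 v1; lra.
  have -> : t c1 - t c2 = x * Q%:R ^+ n.-1 / S.
    by rewrite /t xE; field; rewrite gt_eqF.
  rewrite normrM normfV (gtr0_norm S0) ler_pdivrMr// mul1r normrM.
  by rewrite [`|_ ^+ _|]ger0_norm// exprn_ge0// ltW.
Qed.

(* The entries of the combination supplied by [small_int_comb] are [O(Q)] and
   its eigenvalue is [O(Q ^ (1 - n))], so by [eigen_det_le] its determinant is
   bounded independently of [Q]. *)
Lemma small_eigenvalues (b : 'rV[R]_n) (B : 'I_n -> 'M[int]_n) :
  rat_free b -> (forall i, a *m (B i)^R = b ord0 i *: a) ->
  exists K : nat, forall e : R, 0 < e -> exists Mx : 'M[int]_n * R,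
    [/\ a *m Mx.1^R = Mx.2 *: a, Mx.2 != 0, `|Mx.2| < e & (`|\det Mx.1| <= K)%N].
Proof.
move=> fb hB.
pose i0 := Ordinal (ltnW hn).
pose S := \sum_i `|b ord0 i|.
pose beta := \sum_i \sum_k \sum_l `|B i k l|.
have beta0 : 0 <= beta by do 3!apply: sumr_ge0 => ? _.
pose C := (S * (\sum_k `|a ord0 k|) * (n.-1`!%:R * beta%:~R ^+ n.-1)) / `|a ord0 i0| : R.
exists (Num.truncn C) => e e0.
(* Large enough that [S / Q < e]; as [n.-1 >= 1], this forces [|x| <= S / Q ^ n.-1 < e]. *)
pose Q := (Num.truncn (S / e)).+1.
have QR : 0 < Q%:R :> R by rewrite ltr0n.
have hQ : S < e * Q%:R by rewrite mulrC -ltr_pdivrMr// truncnS_gt.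
have [c] := small_int_comb b Q isT fb.
set x := \sum_i _ => -[hc x0 hx].
pose M := \sum_i c i *: B i.
have hM : a *m M^R = x *: a.
  rewrite /M raddf_sum mulmx_sumr scaler_suml; apply: eq_bigr => i _.
  by rewrite /= map_mxZ -scalemxAr hB scalerA.
exists (M, x); split => //=.
- rewrite -(@ltr_pM2r _ Q%:R)//; apply: le_lt_trans hQ; apply: le_trans hx.
  rewrite ler_wpM2l// ler_eXnr// ?ler1n//; lia.
- rewrite -ltnS -(ltr_nat R); apply: le_lt_trans (truncnS_gt _).
  rewrite ler_pdivlMr ?normr_gt0 ?rat_free_neq0// -[_%:R]/(`|\det M|%:~R) mulrC.
  have hMB i j : `|M i j|%:~R <= (Q%:R * beta%:~R : R).
    rewrite -[Q%:R]/((Posz Q)%:~R) -intrM ler_int /M summxE mulr_sumr.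
    apply: (le_trans (ler_norm_sum _ _ _)); apply: ler_sum => k _.
    rewrite mxE normrM; apply: ler_pM => //.
    rewrite (bigD1 i)//= (bigD1 j)//= -addrA lerDl addr_ge0 ?sumr_ge0// => u _.
    exact: sumr_ge0.
  apply: (le_trans (eigen_det_le i0 _ _ _ hM hMB)).
  rewrite exprMn.
  set P := \sum_k _; set f := _%:R; set g := _ ^+ n.-1 in hx *.
  have -> : `|x| * P * (f * (g * beta%:~R ^+ n.-1)) =
    (`|x| * g) * (P * (f * beta%:~R ^+ n.-1)) by ring.
  rewrite -[leRHS]mulrA ler_wpM2r// !mulr_ge0 ?sumr_ge0// exprn_ge0// ler0z//.
Qed.

Lemma nontrivial_unit (b : 'rV[R]_n) (B : 'I_n -> 'M[int]_n) :
  rat_free b -> (forall i, a *m (B i)^R = b ord0 i *: a) ->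
  exists U V : 'M[int]_n, exists x : R,
    [/\ U *m V = 1%:M, a *m U^R = x *: a, x != 0 & `|x| != 1].
Proof.
move=> fb hB.
have [K hK] := small_eigenvalues b B fb hB.
have /choice[F hF] : forall e : R, exists Mx : 'M[int]_n * R, 0 < e ->
    [/\ a *m Mx.1^R = Mx.2 *: a, Mx.2 != 0, `|Mx.2| < e & (`|\det Mx.1| <= K)%N].
  move=> e; have [e0|e0] := ltP 0 e; last by exists (0, 0).
  by have [Mx h] := hK e e0; exists Mx.
(* Each eigenvalue serves as the bound for the next, so their absolute values strictly decrease and
   distinct indices never give equal ones. *)
pose s := fix s k := F (if k is k'.+1 then `|(s k').2| else 1).
have hs k : [/\ a *m (s k).1^R = (s k).2 *: a, (s k).2 != 0 &
    (`|\det (s k).1| <= K)%N].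
  elim: k => [|k [_ h _]] /=; first by have [] := hF 1 ltr01.
  by rewrite -normr_gt0 in h; have [] := hF _ h.
have sS k : `|(s k.+1).2| < `|(s k).2|.
  by have [_ h _] := hs k; rewrite -normr_gt0 in h; have [] := hF _ h.
have slt i j : (i < j)%N -> `|(s j).2| < `|(s i).2|.
  elim: j => // j ih; rewrite ltnS leq_eqVlt => /predU1P[->//|/ih].
  exact: lt_trans.
have hd k : \det (s k).1 != 0 by have [h h0 _] := hs k; exact: eigen_det_neq0 h0 h.
(* Finitely many colours: the determinant lies in [[-K, K]] and is shifted to [[0, 2K]], and
   residues modulo it are smaller than [K.+1]. Hence no [inord] falls back on its default value. *)
pose colour k : 'I_(K.*2.+1) * {ffun 'I_n * 'I_n -> 'I_K.+1} :=
  (inord `|\det (s k).1 + K%:Z|,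
   [ffun p => inord `|((s k).1 p.1 p.2 %% \det (s k).1)%Z|%N]).
have : ~~ injectiveb (fun i :
    'I_(#|{: 'I_(K.*2.+1) * {ffun 'I_n * 'I_n -> 'I_K.+1}}|.+1) => colour i).
  by apply/injectiveP => /leq_card; rewrite card_ord ltnn.
case/injectivePn => i [j ij] /= [].
move: (hs i) (hs j) (hd i) (hd j).
have : `|(s j).2 / (s i).2| != 1.
  have ni : 0 < `|(s i).2| by rewrite normr_gt0; have [] := hs i.
  rewrite normrM normfV -(inj_eq (mulIf (lt0r_neq0 ni))) divfK ?(gt_eqF ni)// mul1r.
  have := ij; rewrite -val_eqE neq_ltn => /orP[/slt|/slt] h.
    by rewrite lt_eqF.
  by rewrite gt_eqF.
move: (s i) (s j) => [Y y] [X x] /= xy [hY y0 kY] [hX x0 kX] dY dX.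
move=> /(congr1 val); rewrite /= !inordK; [|lia|lia] => eXY.
have {}eXY : \det Y = \det X by lia.
move=> /ffunP hm.
have hmod k l : (Y k l %% \det Y)%Z = (X k l %% \det Y)%Z.
  have /(congr1 val) := hm (k, l); rewrite !ffunE /= -eXY.
  have := modz_ge0 (Y k l) dY; have := modz_ge0 (X k l) dY.
  have := ltz_mod (Y k l) dY; have := ltz_mod (X k l) dY.
  by move=> ? ? ? ?; rewrite !inordK; lia.
pose Z := \matrix_(k, l) ((X k l %/ \det Y)%Z - (Y k l %/ \det Y)%Z).
have XE : X = Y + \det Y *: Z.
  apply/matrixP => k l; rewrite !mxE.
  rewrite [LHS](divz_eq _ (\det Y)) {1}[Y k l](divz_eq _ (\det Y)) hmod; ring.
(* This is [Y^-1 X] written without division: since [Y *m \adj Y] is the scalar [\det Y], the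
   product [Y *m U] equals [Y + \det Y *: Z = X]. *)
pose U := 1%:M + \adj Y *m Z.
have YU : Y *m U = X.
  by rewrite mulmxDr mulmx1 mulmxA mul_mx_adj mul_scalar_mx -XE.
have dU : \det U = 1.
  by apply: (mulfI dY); rewrite -det_mulmx YU -eXY mulr1.
exists U, (\adj U), (x / y); split => //.
- by rewrite mul_mx_adj dU.
(* [y (a U) = a Y U = a X = x a]. *)
- apply: (scalerI y0); rewrite scalemxAl -hY -mulmxA -map_mxM YU hX scalerA.
  by rewrite mulrCA divff// mulr1.
- by rewrite mulf_neq0// invr_eq0.
Qed.

End IntegerEigenMatrices.

(** Multiplication by [a_i] has a rational matrix in the basis [a]. A common denominator [D] of all
    the structure constants makes multiplication by each [D * a_i] integral, so that
    [nontrivial_unit] applies with [b = D *: a]. *)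
Lemma number_field_unit (R : realType) (n : nat) (a : 'rV[R]_n) (F : {pred R}) :
  (2 <= n)%N -> divring_closed F -> rat_basis F a ->
  exists U V : 'M[int]_n, exists x : R,
    [/\ U *m V = 1%:M, a *m map_mx intr U = x *: a, x != 0 & `|x| != 1].
Proof.
move=> hn [F1 _ Fdiv] [fa Fa].
have Fmul x y : x \in F -> y \in F -> x * y \in F.
  by move=> hx hy; rewrite -[y]invrK -[y^-1]mul1r Fdiv// Fdiv.
have Fai i : a ord0 i \in F.
  apply/Fa; exists (fun j => (j == i)%:R); rewrite /rat_comb (bigD1 i)//= eqxx.
  rewrite rmorph1 mul1r big1 ?addr0// => j /negbTE ->.
  by rewrite rmorph0 mul0r.
have /choice[c hc] : forall p : 'I_n * 'I_n, exists c : 'I_n -> rat,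
    a ord0 p.1 * a ord0 p.2 = rat_comb c a by move=> p; apply/Fa; exact: Fmul.
pose D := \prod_(t : 'I_n * 'I_n * 'I_n) denq (c t.1 t.2).
have D0 : D != 0 by apply/prodf_neq0 => t _; exact: denq_neq0.
have hD t : exists z : int, z%:~R = D%:~R * c t.1 t.2.
  exists (numq (c t.1 t.2) * \prod_(u | u != t) denq (c u.1 u.2)).
  by rewrite /D [in RHS](bigD1 t)//= !intrM numqE; ring.
have /choice[z hz] := hD.
have D0R : D%:~R != 0 :> R by rewrite intr_eq0.
apply: (@nontrivial_unit R n a hn fa (D%:~R *: a)
  (* [a] multiplies from the left, so column [j] holds the coordinates of [D * a_i * a_j]. *)
  (fun i => \matrix_(k, j) z ((i, j), k))); first exact: rat_freeZ.
move=> i; apply/rowP => j; rewrite !mxE -mulrA (hc (i, j)) /rat_comb mulr_sumr.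
apply: eq_bigr => k _; rewrite !mxE -[(z _)%:~R]ratr_int hz rmorphM/= ratr_int.
by ring.
Qed.

(** * Toral automorphisms *)

Lemma Ck_on_cst {R : realType} {V W : normedModType R} k (U : set V) (w : W) :
  Ck_on k U (fun=> w).
Proof.
elim: k w => [|k ih] w /=; first by move=> x _; exact: cvg_cst.
split=> [x _|v]; first exact: differentiable_cst.
have -> : (fun x : V => 'D_v (fun=> w) x) = fun=> 0; last exact: ih.
by apply/funext => x; rewrite derive_cst.
Qed.

Section ToralAutomorphisms.
Variables (R : realType) (n : nat).
Local Notation T := (torus R n).
Local Notation "M '^R'" := (map_mx (intr : int -> R) M) (at level 2).

Lemma torus_reprK (p : T) : torus_pi (torus_repr p) = p.
Proof. exact: reprK. Qed.

Lemma torus_piP (x y : 'rV[R]_n) :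
  torus_pi x = torus_pi y <-> forall i, (x - y) ord0 i \is a Num.int.
Proof.
rewrite /torus_pi; split.
  by move=> /eqmodP/forallP.
by move=> h; apply/eqmodP; apply/forallP.
Qed.

Definition toral_map (M : 'M[int]_n) (p : T) : T :=
  torus_pi (torus_repr p *m M^R).

(** Integer matrices preserve the lattice of integer vectors, so the image does not depend on the
    representative picked by [torus_repr]. *)
Lemma toral_map_pi M (x : 'rV[R]_n) :
  toral_map M (torus_pi x) = torus_pi (x *m M^R).
Proof.
apply/torus_piP => i; rewrite -mulmxBl mxE rpred_sum// => j _.
rewrite rpredM// ?mxE ?intr_int//.
by have /torus_piP/(_ j) := torus_reprK (torus_pi x); rewrite !mxE.
Qed.

Lemma toral_mapK (M N : 'M[int]_n) :
  M *m N = 1%:M -> cancel (toral_map M) (toral_map N).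
Proof.
move=> MN p; rewrite -[in LHS](torus_reprK p) !toral_map_pi -mulmxA -map_mxM MN.
by rewrite map_mx1 mulmx1 torus_reprK.
Qed.

Lemma continuous_mulmxr (A : 'M[R]_n) :
  continuous (mulmxr A : 'rV[R]_n -> 'rV[R]_n).
Proof.
have -> : mulmxr A = fun y => \sum_i y ord0 i *: row i A.
  by apply/funext => y; exact: mulmx_sum_row.
apply: continuous_big => [|i _ x]; first exact: add_continuous.
exact: (@cvgZr_tmp R 'rV[R]_n _ (nbhs x) _ _ _ (row i A)
  (@coord_continuous R 1 n ord0 i x)).
Qed.

Lemma differentiable_mulmxr (A : 'M[R]_n) (x : 'rV[R]_n) :
  differentiable (mulmxr A : 'rV[R]_n -> 'rV[R]_n) x.
Proof. apply: linear_differentiable; exact: continuous_mulmxr. Qed.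

Lemma derive_mulmxr (A : 'M[R]_n) (x v : 'rV[R]_n) :
  'D_v (mulmxr A : 'rV[R]_n -> 'rV[R]_n) x = v *m A.
Proof.
rewrite deriveE; last exact: differentiable_mulmxr.
by rewrite (@diff_lin _ _ _ (mulmxr A))//; exact: continuous_mulmxr.
Qed.

Lemma smooth_mulmxr (A : 'M[R]_n) (U : set 'rV[R]_n) :
  smooth_on U (fun x : 'rV[R]_n => x *m A).
Proof.
case=> [|k] /=; first by move=> x _; exact: continuous_mulmxr.
split=> [x _|v]; first exact: differentiable_mulmxr.
have -> : (fun x : 'rV[R]_n => 'D_v (fun x : 'rV[R]_n => x *m A) x) = fun=> v *m A.
  by apply/funext => x; exact: derive_mulmxr.
exact: Ck_on_cst.
Qed.

Lemma toral_map_smooth M : smooth_torus_map (toral_map M).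
Proof.
move=> x; exists setT, (fun x : 'rV[R]_n => x *m M^R); split => //.
- exact: openT.
- exact: smooth_mulmxr.
- by move=> y _; rewrite toral_map_pi.
Qed.

Definition toral_diffeo (M N : 'M[int]_n) (MN : M *m N = 1%:M) : diffeo R n :=
  @Diffeo R n (toral_map M) (toral_map N) (toral_mapK _ _ MN)
    (toral_mapK _ _ (mulmx1C MN)) (toral_map_smooth M) (toral_map_smooth N).

(* The difference of two lifts is integer-valued and continuous at [x], hence
   constant near [x]. *)
Lemma near_lift_eq (F G : 'rV[R]_n -> 'rV[R]_n) (x : 'rV[R]_n) :
  {for x, continuous F} -> {for x, continuous G} ->
  (\forall y \near x, torus_pi (F y) = torus_pi (G y)) ->
  \forall y \near x, F y = G y + (F x - G x).
Proof.
move=> cF cG h.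
have hx := nbhs_singleton h.
have cH : (F \- G) y @[y --> x] --> F x - G x.
  exact: (@cvgB _ _ _ (nbhs x) _ F G _ _ cF cG).
have /cvg_ballP/(_ _ ltr01) := cH.
move=> hd; near=> y.
rewrite addrC -[LHS](subrK (G y)); congr (_ + _).
apply/rowP => i.
have hy : torus_pi (F y) = torus_pi (G y) by near: y.
have /torus_piP/(_ i)/intrP[u hu] := hx.
have /torus_piP/(_ i)/intrP[v hv] := hy.
have [_ /(_ ord0 i)] : ball (F x - G x) 1 ((F \- G) y) by near: y.
(* Both differences of lifts are integers, and integers at distance less than 1 coincide. *)
rewrite /ball/= hu hv -rmorphB /= -intr_norm -[1]/(1%:~R) ltr_int.
move=> uv; congr (_%:~R); lia.
Unshelve. all: end_near.
Qed.

(** The linear map [mulmxr] is one differentiable lift, so [xget] does return a lift; by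
    [near_lift_eq] it differs from the linear one by a constant near the point and has the same
    derivative. *)
Lemma tangent_toral_map M (p : T) (v : 'rV[R]_n) :
  tangent_map (toral_map M) p v = v *m M^R.
Proof.
rewrite /tangent_map /tangent_to_torus.
set x := torus_repr p.
set P := [set F | _].
have dM := differentiable_mulmxr M^R.
have : P (xget (fun=> 0) P).
  apply: (@xgetI _ (fun=> 0) P (mulmxr M^R)); split => //.
  by near=> y; rewrite toral_map_pi.
set F := xget _ _ => -[hF dF].
have eF : \forall y \near x, F y = y *m M^R + (F x - x *m M^R).
  apply: near_lift_eq; [exact: differentiable_continuous|
    exact: (differentiable_continuous (dM x))|].
  by near do rewrite -toral_map_pi.
rewrite -deriveE// (near_eq_derive v eF) deriveD// ?derive_mulmxr ?derive_cst ?addr0//.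
exact/diff_derivable/dM.
Unshelve. all: end_near.
Qed.

Lemma toral_diffeo_multiplier (psi : smooth_flow R n) (a : 'rV[R]_n)
    (M N : 'M[int]_n) (MN : M *m N = 1%:M) (x : R) :
  generated_by_constant psi a -> a != 0 -> x != 0 -> a *m M^R = x *: a ->
  multiplier_group psi x.
Proof.
move=> ga a0 x0 hM.
have hx : has_multiplier psi (toral_diffeo M N MN) x.
  by split=> // p; rewrite /Defs.pushforward !ga -hM; exact: tangent_toral_map.
exists (toral_diffeo M N MN); first by exists x.
(* Any multiplier [y] chosen by [xget] satisfies [y *: a = x *: a], hence equals [x] because
   [a != 0]. *)
rewrite /multiplier; case: xgetP => [y _ [_ /(_ (torus_pi 0))]|/(_ x)//].
rewrite hx.2 ga => /eqP; rewrite -subr_eq0 -scalerBl scaler_eq0 (negbTE a0) orbF.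
by rewrite subr_eq0 => /eqP.
Qed.

End ToralAutomorphisms.

Theorem theorem3p6 (R : realType) (n : nat) (hn : (2 <= n)%N)
    (psi : smooth_flow R n) (hpsi : quasiperiodic psi)
    (hM : multiplier_group psi = [set 1; -1]) :
  transcendental psi.
Proof.
split=> // F [divF _] [a [ga fa [theta theta0 Fa]]].
have [U [V [x [UV Ua x0 x1]]]] := number_field_unit _ _ _ _ hn divF Fa.
(* The eigenvector equation is homogeneous, so it passes from the basis [theta *: a] to [a]
   itself. *)
have {}Ua : a *m map_mx intr U = x *: a.
  by apply: (scalerI theta0); rewrite scalemxAl Ua !scalerA mulrC.
have a0 : a != 0.
  apply/eqP => /rowP/(_ (Ordinal (ltnW hn))); rewrite [RHS]mxE.
  by apply/eqP; exact: rat_free_neq0.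
have := toral_diffeo_multiplier _ _ _ _ _ _ UV _ ga a0 x0 Ua.
by rewrite hM => -[] xE; move: x1; rewrite xE ?normrN normr1 eqxx.
Qed.
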